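(* Consider a centered sub-gaussian distribution in $\mathbb{R}^n$ with covariance matrix $\Sigma$, let $X$ be a random vector with this distribution, let $\Sigma_N$ denote the sample covariance matrix formed from $N$ independent samples of the distribution, and let $\varepsilon \in (0,1)$, $t \ge 1$. If $$N \ge C (t/\varepsilon)^2 n,$$ then with probability at least $1 - 2\exp(-t^2 n)$ one has $$\|\Sigma_N - \Sigma\| \le \varepsilon.$$ Here $C = C_K > 0$ depends only on the sub-gaussian norm $K = \|X\|_{\psi_2}$.
   Context: For a centered random vector $X$ in $\mathbb{R}^n$ ($\mathbb{E}X=0$), the covariance matrix is $\Sigma = \mathbb{E}\,XX^T$. Given $N$ independent samples $X_1,\dots,X_N$ from the distribution of $X$, the sample covariance matrix is $\Sigma_N = \frac1N \sum_{i=1}^N X_i X_i^T$. $\|\cdot\|$ applied to a matrix is the spectral (operator) norm. The sub-gaussian norm of a random variable $Z$ is $\|Z\|_{\psi_2} = \sup_{p \ge 1} p^{-1/2} (\mathbb{E}|Z|^p)^{1/p}$, and $Z$ is sub-gaussian if this is finite. A random vector $X$ in $\mathbb{R}^n$ is sub-gaussian if $\langle X,x\rangle$ is sub-gaussian for every $x\in\mathbb{R}^n$, and $\|X\|_{\psi_2} = \sup_{x \in S^{n-1}} \|\langle X,x\rangle\|_{\psi_2}$, where $S^{n-1}$ is the unit Euclidean sphere. *)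

(* Defs.v *)
From HB Require Import structures.
From mathcomp Require Import all_boot all_order all_algebra.
From mathcomp Require Import all_classical all_reals all_analysis.

Set Implicit Arguments.
Unset Strict Implicit.
Unset Printing Implicit Defensive.

Import Order.TTheory GRing.Theory Num.Theory.
Import numFieldNormedType.Exports.

Local Open Scope classical_set_scope.
Local Open Scope ring_scope.

(* R^n as column vectors, with its Borel sigma-algebra: the library topology on
   matrices is the product (sup-norm) topology, i.e. the Euclidean one.
   A random vector on (T, P) is an element of {RV P >-> borelRn R n}. *)
Definition borelRn (R : realType) (n : nat) :=
  g_sigma_algebraType (@open 'cV[R]_n).

Definition dotv (R : realType) (n : nat) (x y : 'cV[R]_n) : R :=
  \sum_(i < n) x i ord0 * y i ord0.

(* The library norm `|x| on matrices is the sup norm, hence this definition. *)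
Definition l2norm (R : realType) (n : nat) (x : 'cV[R]_n) : R :=
  Num.sqrt (dotv x x).

Definition unit_sphere (R : realType) (n : nat) : set 'cV[R]_n :=
  [set x | l2norm x = 1].
Arguments unit_sphere : clear implicits.

Definition spectral_norm (R : realType) (m n : nat) (A : 'M[R]_(m, n)) : R :=
  sup [set l2norm (A *m x) | x in unit_sphere R n].

Section RandomVectors.
Context (R : realType) (d : measure_display) (T : measurableType d).
Variable P : probability T R.

Definition psi2_norm (Z : T -> R) : \bar R :=
  ereal_sup [set ((p `^ (- 2^-1))%R%:E * 'N[P]_(p%:E)[EFin \o Z])%E
            | p in [set p : R | 1 <= p]].

Definition sub_gaussian (Z : T -> R) : Prop := (psi2_norm Z < +oo)%E.

Variable n : nat.
Implicit Type X : {RV P >-> borelRn R n}.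

Definition marginal X (x : 'cV[R]_n) : T -> R := fun w => dotv (X w) x.

Definition sub_gaussian_vec X : Prop := forall x, sub_gaussian (marginal X x).

Definition psi2_norm_vec X : \bar R :=
  ereal_sup [set psi2_norm (marginal X x) | x in unit_sphere R n].

Definition outer (x : 'cV[R]_n) : 'M[R]_n := x *m x^T.

Definition centered X : Prop :=
  forall i : 'I_n, 'E_P[fun w => (X w : 'cV[R]_n) i ord0]%E = 0%E.

(* E X X^T, entrywise; for sub-gaussian X these expectations are finite. *)
Definition covariance_mx X : 'M[R]_n :=
  \matrix_(i < n, j < n) fine ('E_P[fun w => outer (X w) i j])%E.

Definition sample_covariance_mx (N : nat)
    (Xs : 'I_N -> {RV P >-> borelRn R n}) (w : T) : 'M[R]_n :=
  N%:R^-1 *: \sum_(i < N) outer (Xs i w).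

Definition mutually_independent (I : finType)
    (Xs : I -> {RV P >-> borelRn R n}) : Prop :=
  forall (J : {set I}) (B : I -> set (borelRn R n)),
    (forall i, measurable (B i)) ->
    P [set w | forall i, i \in J -> B i (Xs i w)] =
    (\prod_(i in J) P (Xs i @^-1` B i))%E.

End RandomVectors.

Definition same_distribution (R : realType) (n : nat)
    (d1 d2 : measure_display) (T1 : measurableType d1) (T2 : measurableType d2)
    (P1 : probability T1 R) (P2 : probability T2 R)
    (X : {RV P1 >-> borelRn R n}) (Y : {RV P2 >-> borelRn R n}) : Prop :=
  forall B : set (borelRn R n), measurable B ->
    distribution P1 X B = distribution P2 Y B.

(* Main.v *)
(* For y in a ball of radius 1, the marginals <X_i, y> are sub-gaussian, so
   <X_i, y>^2 - E <X_i, y>^2 is sub-exponential and Chernoff's bound controls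
   <(Sigma_N - Sigma) y, y> up to probability exp (- c eps^2 N).  It then suffices
   to take a union bound over a finite 1/4-net of the sphere, with at most
   exp (18 n) points, on which the quadratic form of a symmetric matrix determines
   the norm up to a factor 2.  The net is made of the points of the lattice
   (4 sqrt n)^-1 Z^n in the unit ball: rounding toward 0 coordinatewise shows that
   it is 1/4-dense, and an exponential-weight count replaces the usual volume
   argument. *)
Require Import Defs.
From HB Require Import structures.
From mathcomp Require Import all_boot all_order all_algebra.
From mathcomp Require Import all_classical all_reals all_analysis.
From mathcomp Require Import measurable_realfun.
From mathcomp Require Import ring lra.

Set Implicit Arguments.
Unset Strict Implicit.
Unset Printing Implicit Defensive.

Import Order.TTheory GRing.Theory Num.Theory.
Import numFieldNormedType.Exports.

Local Open Scope classical_set_scope.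
Local Open Scope ring_scope.


(** * Euclidean and spectral norms *)

(** A sub-exponential average has a gaussian tail for small deviations and only an exponential one
    for large deviations. Replacing the sub-gaussian norm by [L], its maximum with 1, and using
    deviations at most 1 keeps everything in the gaussian regime, so a single exponent, quadratic in
    the deviation, suffices. Two obstacles come from the definitions. Independence speaks of events
    only, so the factorization of the expectation of a product has to be derived from it before
    moment generating functions can be multiplied. And the final event involves a supremum over the
    uncountable sphere; its measurability comes from testing the matrix on all lattice points, a
    countable family that is dense in direction. The lattice that supplies the net thus serves a
    second time, with arbitrarily fine mesh. *)

Section Euclidean.
Context (R : realType).

Section VectorNorm.
Variable n : nat.
Implicit Types (x y z : 'cV[R]_n) (a : R).

Lemma dotvC x y : dotv x y = dotv y x.
Proof. by apply: eq_bigr => i _; rewrite mulrC. Qed.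

Lemma dotvDl x y z : dotv (x + y) z = dotv x z + dotv y z.
Proof.
by rewrite -big_split; apply: eq_bigr => i _; rewrite mxE mulrDl.
Qed.

Lemma dotvZl a x y : dotv (a *: x) y = a * dotv x y.
Proof. by rewrite /dotv mulr_sumr; apply: eq_bigr => i _; rewrite mxE mulrA. Qed.

Lemma dotvDr x y z : dotv x (y + z) = dotv x y + dotv x z.
Proof. by rewrite !(dotvC x) dotvDl. Qed.

Lemma dotvZr a x y : dotv x (a *: y) = a * dotv x y.
Proof. by rewrite !(dotvC x) dotvZl. Qed.

Lemma dotvNl x y : dotv (- x) y = - dotv x y.
Proof. by rewrite -scaleN1r dotvZl mulN1r. Qed.

Lemma dotvNr x y : dotv x (- y) = - dotv x y.
Proof. by rewrite !(dotvC x) dotvNl. Qed.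

Lemma dotv_ge0 x : 0 <= dotv x x.
Proof. by apply: sumr_ge0 => i _; rewrite -expr2 sqr_ge0. Qed.

Lemma dotv_eq0 x : (dotv x x == 0) = (x == 0).
Proof.
apply/eqP/eqP => [|->]; last by rewrite /dotv big1// => i _; rewrite mxE mul0r.
move=> /eqP; rewrite psumr_eq0 => [/allP x0|i _]; last by rewrite -expr2 sqr_ge0.
apply/matrixP => i j; rewrite (ord1 j) mxE.
by have := x0 i (mem_index_enum i); rewrite mulf_eq0 orbb => /eqP.
Qed.

Lemma l2norm_ge0 x : 0 <= l2norm x.
Proof. exact: sqrtr_ge0. Qed.

Lemma sqr_l2norm x : l2norm x ^+ 2 = dotv x x.
Proof. by rewrite sqr_sqrtr ?dotv_ge0. Qed.

Lemma l2norm_eq0 x : (l2norm x == 0) = (x == 0).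
Proof. by rewrite -dotv_eq0 -sqr_l2norm sqrf_eq0. Qed.

Lemma l2norm0 : l2norm (0 : 'cV[R]_n) = 0.
Proof. by apply/eqP; rewrite l2norm_eq0. Qed.

Lemma l2normZ a x : l2norm (a *: x) = `|a| * l2norm x.
Proof.
by rewrite /l2norm dotvZl dotvZr mulrA -expr2 sqrtrM ?sqr_ge0// sqrtr_sqr.
Qed.

Lemma l2norm_normalize x : x != 0 -> l2norm ((l2norm x)^-1 *: x) = 1.
Proof.
move=> x0; rewrite l2normZ ger0_norm ?invr_ge0 ?l2norm_ge0// mulVf//.
by rewrite l2norm_eq0.
Qed.

Lemma sqr_dotv_le x y : dotv x y ^+ 2 <= dotv x x * dotv y y.
Proof.
have [->|y0] := eqVneq y 0.
  by rewrite dotvC -(scale0r y) !dotvZl !mul0r mulr0 expr0n.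
have yp : 0 < dotv y y by rewrite lt_def dotv_ge0 dotv_eq0 y0.
(* The squared length of this vector is [dotv y y] times the difference of the two sides of the
   goal. *)
have := dotv_ge0 (dotv y y *: x - dotv x y *: y).
rewrite dotvDl !dotvDr !dotvNl !dotvNr !dotvZl !dotvZr (dotvC y x) => h.
rewrite -subr_ge0 -(pmulr_rge0 _ yp).
apply: le_trans h _.
rewrite le_eqVlt; apply/orP; left; apply/eqP; ring.
Qed.

Lemma normr_dotv_le x y : `|dotv x y| <= l2norm x * l2norm y.
Proof.
rewrite -(ler_pXn2r (ltn0Sn 1)) ?nnegrE ?mulr_ge0 ?l2norm_ge0//.
by rewrite exprMn !sqr_l2norm real_normK ?num_real// sqr_dotv_le.
Qed.

Lemma l2norm_triangle x y : l2norm (x + y) <= l2norm x + l2norm y.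
Proof.
rewrite -(ler_pXn2r (ltn0Sn 1)) ?nnegrE ?addr_ge0 ?l2norm_ge0//.
rewrite sqr_l2norm sqrrD !sqr_l2norm dotvDl !dotvDr (dotvC y x).
have := normr_dotv_le x y; have := ler_norm (dotv x y).
by move=> h1 h2; have := le_trans h1 h2; lra.
Qed.

Lemma l2norm_le_sqrt x a : 0 <= a -> (forall i, `|x i ord0| <= a) ->
  l2norm x <= Num.sqrt n%:R * a.
Proof.
move=> a0 xa.
rewrite -(ler_pXn2r (ltn0Sn 1)) ?nnegrE ?mulr_ge0 ?sqrtr_ge0 ?l2norm_ge0//.
rewrite sqr_l2norm exprMn sqr_sqrtr ?ler0n//.
rewrite mulr_natl -[in leRHS](card_ord n) -sumr_const ler_sum// => i _.
by rewrite -expr2 -(real_normK (num_real (x i ord0))) lerXn2r// nnegrE.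
Qed.

Lemma l2norm_mono x y : (forall i, `|x i ord0| <= `|y i ord0|) ->
  l2norm x <= l2norm y.
Proof.
move=> xy; apply: ler_wsqrtr; apply: ler_sum => i _.
by rewrite -!expr2 -(real_normK (num_real (x i ord0)))
  -(real_normK (num_real (y i ord0))) lerXn2r ?nnegrE.
Qed.

Lemma normr_coord_le_l2norm x i : `|x i ord0| <= l2norm x.
Proof.
rewrite /l2norm -sqrtr_sqr ler_wsqrtr// /dotv (bigD1 i)//= expr2 lerDl.
by apply: sumr_ge0 => j _; rewrite -expr2 sqr_ge0.
Qed.

Lemma dotv_delta x i : dotv x (delta_mx i ord0) = x i ord0.
Proof.
rewrite /dotv (bigD1 i)//= big1 ?addr0 => [|j ji].
  by rewrite mxE !eqxx mulr1.
by rewrite mxE (negbTE ji) mulr0.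
Qed.

Lemma l2norm_delta (i : 'I_n) : l2norm (delta_mx i ord0 : 'cV[R]_n) = 1.
Proof. by rewrite /l2norm dotv_delta mxE !eqxx sqrtr1. Qed.

End VectorNorm.

Section SpectralNorm.
Variables (m n : nat).
Implicit Types (A : 'M[R]_(m, n)).

Lemma dotv_mulmx A (x : 'cV[R]_n) y : dotv (A *m x) y = dotv x (A^T *m y).
Proof.
have dE k (u v : 'cV[R]_k) : dotv u v = (u^T *m v) ord0 ord0.
  by rewrite mxE; apply: eq_bigr => i _; rewrite mxE.
by rewrite !dE trmx_mul mulmxA.
Qed.

(** The witness is the Frobenius norm, by Cauchy-Schwarz on each row. Boundedness is what makes the
    [sup] in [spectral_norm] a genuine supremum instead of a default value. *)
Lemma l2norm_mulmx_bounded A :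
  exists2 F, 0 <= F & forall x, l2norm (A *m x) <= F * l2norm x.
Proof.
pose S := \sum_(i < m) \sum_(j < n) A i j ^+ 2.
have S0 : 0 <= S by apply: sumr_ge0 => i _; apply: sumr_ge0 => j _; exact: sqr_ge0.
exists (Num.sqrt S); first exact: sqrtr_ge0.
move=> x; rewrite -sqrtrM//; apply: ler_wsqrtr.
rewrite mulr_suml; apply: ler_sum => i _; rewrite -expr2.
have := sqr_dotv_le ((row i A)^T) x.
rewrite /dotv mxE; under eq_bigr do rewrite !mxE; move/le_trans; apply.
by rewrite le_eqVlt; apply/orP; left; apply/eqP; congr (_ * _);
  apply: eq_bigr => j _; rewrite !mxE -expr2.
Qed.

Lemma l2norm_mulmx_le A x : l2norm (A *m x) <= spectral_norm A * l2norm x.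
Proof.
have [->|x0] := eqVneq x 0; first by rewrite mulmx0 !l2norm0 mulr0.
have xp : 0 < l2norm x by rewrite lt_def l2norm_ge0 l2norm_eq0 x0.
rewrite -ler_pdivrMr// mulrC -[X in X * _]ger0_norm ?invr_ge0 ?l2norm_ge0//.
rewrite -l2normZ scalemxAr; apply: ub_le_sup; last first.
  by exists ((l2norm x)^-1 *: x) => //; exact: l2norm_normalize.
have [F F0 FA] := l2norm_mulmx_bounded A.
by exists F => _ [y /= y1 <-]; rewrite (le_trans (FA y))// y1 mulr1.
Qed.

Lemma unit_sphere_neq0 : (0 < n)%N -> unit_sphere R n !=set0.
Proof.
by move=> n0; exists (delta_mx (Ordinal n0) ord0); exact: l2norm_delta.
Qed.

Lemma spectral_norm_le A (e : R) : (0 < n)%N ->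
  (forall x, l2norm x = 1 -> l2norm (A *m x) <= e) -> spectral_norm A <= e.
Proof.
move=> n0 Ae; apply: ge_sup; last by move=> _ [x x1 <-]; exact: Ae.
by have [x x1] := unit_sphere_neq0 n0; exists (l2norm (A *m x)), x.
Qed.

Lemma spectral_norm_ge0 A : (0 < n)%N -> 0 <= spectral_norm A.
Proof.
move=> n0; have [x x1] := unit_sphere_neq0 n0.
have := l2norm_mulmx_le A x; rewrite x1 mulr1; apply: le_trans.
exact: l2norm_ge0.
Qed.

End SpectralNorm.

(** Polarization: for a unit vector x and y = Ax / |Ax|, symmetry gives 4 <Ax,y> = <A(x+y),x+y> -
    <A(x-y),x-y>, which is at most q (|x+y|^2 + |x-y|^2) = 4 q by the parallelogram law. *)
Lemma spectral_norm_sym_le n (A : 'M[R]_n) (q : R) : (0 < n)%N -> A^T = A ->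
  0 <= q ->
  (forall x, l2norm x = 1 -> `|dotv (A *m x) x| <= q) -> spectral_norm A <= q.
Proof.
move=> n0 symA q0 Aq.
have Aq' x : `|dotv (A *m x) x| <= q * dotv x x.
  have [->|x0] := eqVneq x 0.
    rewrite mulmx0 -(scale0r (0 : 'cV[R]_n)) dotvZl mul0r normr0.
    by rewrite mulr_ge0// dotv_ge0.
  have xp : 0 < l2norm x by rewrite lt_def l2norm_ge0 l2norm_eq0 x0.
  have := Aq _ (l2norm_normalize x0).
  rewrite -scalemxAr dotvZl dotvZr mulrA -expr2 normrM normrX.
  rewrite (ger0_norm (_ : 0 <= (l2norm x)^-1)) ?invr_ge0 ?l2norm_ge0//.
  by rewrite exprVn mulrC ler_pdivrMr ?exprn_gt0// sqr_l2norm.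
apply: spectral_norm_le => // x x1.
have [->|Ax0] := eqVneq (A *m x) 0; first by rewrite l2norm0.
set y := (l2norm (A *m x))^-1 *: (A *m x).
have y1 : l2norm y = 1 by exact: l2norm_normalize.
have -> : l2norm (A *m x) = dotv (A *m x) y.
  rewrite dotvZr -sqr_l2norm expr2 mulrA mulVf ?mul1r// l2norm_eq0//.
have Axy : dotv (A *m y) x = dotv (A *m x) y.
  by rewrite dotv_mulmx symA dotvC.
have h1 := le_trans (ler_norm _) (Aq' (x + y)).
have h2 := le_trans (ler_norm _) (eq_ind_r (fun a => a <= _) (Aq' (x - y)) (normrN _)).
move: h1 h2; rewrite !mulmxDr mulmxN.
rewrite !(dotvDl, dotvDr, dotvNl, dotvNr) Axy -!sqr_l2norm x1 y1 (dotvC y x).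
lra.
Qed.

(* With s the norm of A and y a point within 1/4 of a unit vector x,
   <Ax,x> - <Ay,y> = <Ax,x-y> + <A(x-y),y> is at most s/2, hence s <= q + s/2. *)
Lemma spectral_norm_net_le n (A : 'M[R]_n) (S : set 'cV[R]_n) (q : R) :
  (0 < n)%N -> A^T = A ->
  (forall x, l2norm x = 1 -> exists y,
     [/\ S y, l2norm y <= 1 & l2norm (x - y) <= 4^-1]) ->
  (forall y, S y -> l2norm y <= 1 -> `|dotv (A *m y) y| <= q) ->
  spectral_norm A <= 2 * q.
Proof.
move=> n0 symA netS Sq; set s := spectral_norm A.
have s0 : 0 <= s by exact: spectral_norm_ge0.
have q0 : 0 <= q.
  have [x x1] := @unit_sphere_neq0 n n0; have [y [Sy y1 _]] := netS x x1.
  by apply: le_trans (Sq y Sy y1).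
suff : s <= q + s / 2 by lra.
apply: spectral_norm_sym_le => // [|x x1]; first by rewrite addr_ge0// divr_ge0.
have [y [Sy y1 xy]] := netS x x1.
have -> : dotv (A *m x) x =
    dotv (A *m y) y + (dotv (A *m x) (x - y) + dotv (A *m (x - y)) y).
  by rewrite mulmxDr mulmxN !(dotvDl, dotvDr, dotvNl, dotvNr); ring.
rewrite (le_trans (ler_normD _ _))// lerD ?Sq//.
rewrite (le_trans (ler_normD _ _))//.
have h1 : `|dotv (A *m x) (x - y)| <= s / 4.
  rewrite (le_trans (normr_dotv_le _ _))// ler_pM ?l2norm_ge0//.
  by rewrite (le_trans (l2norm_mulmx_le _ _))// x1 mulr1.
have h2 : `|dotv (A *m (x - y)) y| <= s / 4.
  rewrite (le_trans (normr_dotv_le _ _))// -[leRHS]mulr1 ler_pM ?l2norm_ge0//.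
  by rewrite (le_trans (l2norm_mulmx_le _ _))// ler_wpM2l.
lra.
Qed.

End Euclidean.

(** * Lattice points: a net of the sphere and countably many test vectors *)

Section Lattice.
Context (R : realType) (n : nat).

(** Sign and absolute value are stored separately, so that truncating absolute values rounds toward
    0. A zero coordinate has two codes, which is harmless for an upper bound on the number of
    points. *)
Definition latv (M : nat) (g : {ffun 'I_n -> bool * 'I_M}) : 'cV[R]_n :=
  \col_i ((-1) ^+ (g i).1 * (g i).2%:R).

Lemma dotv_latv M (g : {ffun 'I_n -> bool * 'I_M}) :
  dotv (latv g) (latv g) = \sum_(i < n) ((g i).2 : nat)%:R ^+ 2.
Proof.
by apply: eq_bigr => i _; rewrite mxE -expr2 exprMn -exprM mulnC exprM sqrrN
  expr1n expr1n mul1r.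
Qed.

(* Rounding toward 0 keeps the rounded vector inside every ball around 0 that
   contains x. *)
Lemma latv_round M (x : 'cV[R]_n) (m : R) : 0 < m ->
  (forall i, m * `|x i ord0| < M%:R) ->
  exists g : {ffun 'I_n -> bool * 'I_M},
    l2norm (m^-1 *: latv g) <= l2norm x /\
    l2norm (x - m^-1 *: latv g) <= Num.sqrt n%:R * m^-1.
Proof.
move=> m0 xM; pose k i := Num.truncn (m * `|x i ord0|).
have mN0 : m != 0 by rewrite gt_eqF.
have kP i : m^-1 * (k i)%:R <= `|x i ord0| < m^-1 * (k i)%:R + m^-1.
  have /truncn_itv : 0 <= m * `|x i ord0| by rewrite mulr_ge0// ltW.
  rewrite -/(k i) -natr1 => /andP[h1 h2]; apply/andP; split.
    by rewrite mulrC ler_pdivrMr// mulrC.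
  by rewrite -(ltr_pM2l m0) mulrDr mulrA mulfV// mul1r.
have kM i : (k i < M)%N.
  by rewrite -(ltr_nat R) (le_lt_trans _ (xM i))// truncn_le mulr_ge0// ltW.
exists [ffun i => (x i ord0 < 0, Ordinal (kM i))].
have lE i : (m^-1 *: latv [ffun i => (x i ord0 < 0, Ordinal (kM i))]) i ord0 =
    (-1) ^+ (x i ord0 < 0)%R * (m^-1 * (k i)%:R).
  by rewrite !mxE ffunE /= mulrCA.
split.
  apply: l2norm_mono => i; rewrite lE normrMsign ger0_norm.
    by case/andP: (kP i).
  by rewrite mulr_ge0 ?invr_ge0 ?ler0n// ltW.
apply: l2norm_le_sqrt => [|i]; first by rewrite invr_ge0 ltW.
rewrite mxE [X in _ + X]mxE lE {1}(numEsign (x i ord0)) -mulrBr normrMsign.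
case/andP: (kP i) => h1 h2; rewrite ger0_norm ?subr_ge0//.
by rewrite lerBlDl ltW.
Qed.

(* Each lattice point of squared length at most 16 n has weight
   exp (16 n - |z|^2) >= 1, and the sum of the weights factors over coordinates. *)
Lemma card_latv_le M :
  \sum_(g : {ffun 'I_n -> bool * 'I_M} | dotv (latv g) (latv g) <= 16 * n%:R) 1
  <= expR (18 * n%:R) :> R.
Proof.
pose w (p : bool * 'I_M) : R := expR (- (p.2 : nat)%:R ^+ 2).
have wE (g : {ffun 'I_n -> bool * 'I_M}) :
    \prod_i w (g i) = expR (- dotv (latv g) (latv g)).
  by rewrite dotv_latv -expR_sum sumrN.
apply: (@le_trans _ _ (\sum_(g : {ffun 'I_n -> bool * 'I_M})
    expR (16 * n%:R) * \prod_i w (g i))).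
  rewrite big_mkcond; apply: ler_sum => g _; rewrite wE -expRD.
  case: ifPn => [h|_]; last exact: expR_ge0.
  by rewrite (le_trans _ (expR_ge1Dx _))// lerDl subr_ge0.
rewrite -mulr_sumr -(bigA_distr_bigA (fun=> w)) /= prodr_const card_ord.
rewrite [leRHS](_ : _ = expR (16 * n%:R) * expR 2 ^+ n); last first.
  by rewrite -expRM_natl -expRD; congr expR; ring.
rewrite ler_pM2l ?expR_gt0//; apply: lerXn2r; rewrite ?nnegrE ?expR_ge0//.
  by apply: sumr_ge0 => p _; exact: expR_ge0.
have e2 : 2 <= expR 1 :> R by have := expR_ge1Dx (1 : R).
(* Each coordinate contributes at most 4 <= exp 2: a factor 2 for the sign, and a sum over k of exp
   (- k^2) <= 2^-k, hence at most 2. The total is exp (16 n) exp (2 n). *)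
have -> : \sum_p w p = 2 * \sum_(k < M) expR (- (k : nat)%:R ^+ 2).
  rewrite -(pair_big predT predT
    (fun (_ : bool) (k : 'I_M) => expR (- (k : nat)%:R ^+ 2)))/=.
  by rewrite big_bool /= mulr_natl mulr2n.
have e4 : 4 <= expR 2 :> R.
  have -> : expR 2 = expR 1 * expR 1 :> R by rewrite -expRD.
  by rewrite (_ : 4 = 2 * 2 :> R) ?ler_pM//; ring.
suff h : \sum_(k < M) expR (- (k : nat)%:R ^+ 2) <= 2 - 2 * (2^-1) ^+ M :> R.
  have : 0 <= (2^-1) ^+ M :> R by rewrite exprn_ge0.
  by move: h e4; lra.
elim: (M) => [|k ih]; first by rewrite big_ord0 expr0 mulr1 subrr.
rewrite big_ord_recr /= (exprS 2^-1).
suff : expR (- k%:R ^+ 2) <= 2^-1 ^+ k :> R by lra.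
rewrite expRN exprVn lef_pV2 ?posrE ?expR_gt0 ?exprn_gt0//.
apply: (@le_trans _ _ (expR 1 ^+ k)); first by rewrite lerXn2r ?nnegrE ?expR_ge0.
rewrite -expRM_natl mulr1 ler_expR -natrX ler_nat.
by case: k {ih} => // k; rewrite leq_pmull.
Qed.

(** The mesh 1 / (4 sqrt n) makes the rounding error at most sqrt n times the mesh, that is 1/4. The
    scaled coordinates of a unit vector are at most 4 sqrt n <= 4 n, whence the bound [(4 * n).+1]
    on the indices. *)
Lemma latv_net (x : 'cV[R]_n) : (0 < n)%N -> l2norm x = 1 ->
  exists g : {ffun 'I_n -> bool * 'I_(4 * n).+1},
    let y := (4 * Num.sqrt n%:R)^-1 *: latv g in
    l2norm y <= 1 /\ l2norm (x - y) <= 4^-1.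
Proof.
move=> n0 x1; have s0 : 0 < Num.sqrt n%:R :> R by rewrite sqrtr_gt0 ltr0n.
have sn : Num.sqrt n%:R <= n%:R :> R.
  rewrite -[leRHS]ger0_norm// -sqrtr_sqr ler_wsqrtr// -natrX ler_nat.
  by rewrite leq_pmull.
have xle i : `|x i ord0| <= 1 by rewrite -x1 normr_coord_le_l2norm.
have [|i|g [h1 h2]] := @latv_round (4 * n).+1 x (4 * Num.sqrt n%:R).
- by rewrite mulr_gt0.
- rewrite (@le_lt_trans _ _ (4 * n)%:R) ?ltr_nat// natrM.
  rewrite -[leRHS]mulr1; apply: ler_pM => //; exact: ler_wpM2l.
exists g; split; first by rewrite (le_trans h1)// x1.
by rewrite (le_trans h2)// invfM mulrCA mulfV ?mulr1// gt_eqF.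
Qed.

(** This replaces the sphere by countably many vectors, for the sake of measurability. The
    inequality is homogeneous, so it also holds at every rescaled lattice point; a unit vector is
    within sqrt n / m of such a point of norm at most 1, and any crude bound on A controls the
    error. *)
Lemma spectral_norm_le_latv (A : 'M[R]_n) (e : R) : (0 < n)%N -> 0 <= e ->
  spectral_norm A <= e <->
  forall M (g : {ffun 'I_n -> bool * 'I_M}),
    l2norm (A *m latv g) <= e * l2norm (latv g).
Proof.
move=> n0 e0; split => [Ae M g|Ae].
  by rewrite (le_trans (l2norm_mulmx_le _ _))// ler_wpM2r// l2norm_ge0.
apply: spectral_norm_le => // x x1; have [F F0 FA] := l2norm_mulmx_bounded A.
apply/ler_addgt0Pr => d d0.
have s0 : 0 < Num.sqrt n%:R :> R by rewrite sqrtr_gt0 ltr0n.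
(* Chosen so that F sqrt n / m <= d; adding 1 keeps [m] positive when [F] is 0. *)
pose m := F * Num.sqrt n%:R / d + 1.
have m0 : 0 < m by rewrite ltr_pwDr// divr_ge0 ?mulr_ge0// ltW.
pose M := \max_(i < n) (Num.truncn (m * `|x i ord0|)).+1.
have [//|i|g [h1 h2]] := @latv_round M x m.
  rewrite (lt_le_trans (truncnS_gt _))// ler_nat.
  exact: (@leq_bigmax _ (fun i => (Num.truncn (m * `|x i ord0|)).+1)).
rewrite -[X in A *m X](subrK (m^-1 *: latv g)) mulmxDr addrC.
rewrite (le_trans (l2norm_triangle _ _))// lerD//.
  rewrite -scalemxAr l2normZ (le_trans (ler_wpM2l _ (Ae M g)))//.
  by rewrite mulrCA -l2normZ -[leRHS]mulr1 ler_wpM2l// (le_trans h1)// x1.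
rewrite (le_trans (FA _))// (le_trans (ler_wpM2l F0 h2))//.
by rewrite mulrA ler_pdivrMr// /m mulrDr mulr1 [d * _]mulrC divfK ?gt_eqF// lerDl ltW.
Qed.

End Lattice.

(** * Products of independent variables *)

Section Factorization.
Import HBNNSimple.
Local Open Scope ereal_scope.
Context (R : realType) (d d' : measure_display)
  (T : measurableType d) (S : measurableType d') (P : probability T R).

(** The identity passes from indicators to simple functions by linearity, then to [h] by monotone
    convergence. In the application [W] is the product of the other factors and [c] the product of
    their integrals. *)
Lemma ge0_integral_factor (W : T -> R) (Y : T -> S) (c : R) (h : S -> R) :
  measurable_fun setT W -> (forall w, 0 <= W w)%R ->
  measurable_fun setT Y -> (0 <= c)%R ->
  (forall B, measurable B ->
    \int[P]_w (W w * \1_B (Y w))%:E = c%:E * \int[P]_w (\1_B (Y w))%:E) ->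
  measurable_fun setT h -> (forall y, 0 <= h y)%R ->
  \int[P]_w (W w * h (Y w))%:E = c%:E * \int[P]_w (h (Y w))%:E.
Proof.
move=> mW W0 mY c0 WB mh h0.
have mhE : measurable_fun [set: S] (fun y => (h y)%:E) by exact/measurable_EFinP.
pose f_ := nnsfun_approx measurableT mhE.
have f_h y : (f_ k y)%:E @[k --> \oo] --> (h y)%:E.
  by apply: (cvg_nnsfun_approx measurableT mhE) => // z _; rewrite lee_fin.
have f_nd y : {homo (fun k => f_ k y) : k m / (k <= m)%N >-> (k <= m)%R}.
  by move=> k m km; exact/lefP/nd_nnsfun_approx.
have mfY k : measurable_fun setT (fun w => f_ k (Y w)).
  by apply: measurableT_comp => //; exact: measurable_funP.
have mind B : measurable B -> measurable_fun setT (fun w => \1_B (Y w) : R).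
  by move=> mB; exact: (measurableT_comp (measurable_indic mB) mY).
have simple k :
    \int[P]_w (W w * f_ k (Y w))%:E = c%:E * \int[P]_w (f_ k (Y w))%:E.
  have mB r : measurable (f_ k @^-1` [set r]) by exact: measurable_sfunP.
  have fin : finite_set (range (f_ k)) by exact: fimfunP.
  have r0 r y : (0 <= r * \1_(f_ k @^-1` [set r]) y)%R.
    by rewrite -lee_fin EFinM nnfun_muleindic_ge0.
  transitivity (\sum_(r \in range (f_ k))
      \int[P]_w (W w * (r * \1_(f_ k @^-1` [set r]) (Y w)))%:E).
    rewrite -ge0_integral_fsum//.
    - apply: eq_integral => w _; rewrite (fimfunE (f_ k)) EFinM -fsumEFin//.
      rewrite ge0_mule_fsumr// => r; exact: r0.
    - by move=> r; apply/measurable_EFinP/measurable_funM => //;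
        apply/measurable_funM => //; exact: mind.
    - by move=> r w _; rewrite lee_fin mulr_ge0.
  transitivity (\sum_(r \in range (f_ k))
      c%:E * \int[P]_w (r * \1_(f_ k @^-1` [set r]) (Y w))%:E); last first.
    rewrite -ge0_mule_fsumr; last first.
      by move=> r; apply: integral_ge0 => w _; rewrite lee_fin.
    congr (_ * _); rewrite -ge0_integral_fsum//.
    - by apply: eq_integral => w _; rewrite (fimfunE (f_ k)) fsumEFin.
    - by move=> r; apply/measurable_EFinP/measurable_funM => //; exact: mind.
    - by move=> r w _; rewrite lee_fin.
  apply: eq_fsbigr => r rr.
  have {}r0 : (0 <= r)%R by move: rr; rewrite inE => -[y _ <-].
  under eq_integral do rewrite mulrCA EFinM.
  rewrite ge0_integralZl_EFin//; last 2 first.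
  - by move=> w _; rewrite lee_fin mulr_ge0.
  - by apply/measurable_EFinP/measurable_funM => //; exact: mind.
  rewrite WB// muleCA; congr (_ * _).
  under [RHS]eq_integral do rewrite EFinM.
  rewrite ge0_integralZl_EFin//.
  by apply/measurable_EFinP; exact: mind.
have mhY : measurable_fun setT (fun w => h (Y w)) by exact: measurableT_comp.
have lim1 : \int[P]_w (W w * f_ k (Y w))%:E @[k --> \oo] -->
    \int[P]_w (W w * h (Y w))%:E.
  have -> : \int[P]_w (W w * h (Y w))%:E =
      \int[P]_w limn (fun k => (W w * f_ k (Y w))%:E).
    apply: eq_integral => w _; apply/esym/cvg_lim => //.
    rewrite EFinM; under eq_fun do rewrite EFinM.
    by apply: cvgeZl.
  apply: cvg_monotone_convergence => //.
  - by move=> k; exact/measurable_EFinP/measurable_funM.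
  - by move=> k w _; rewrite lee_fin mulr_ge0.
  - by move=> w _ k m km; rewrite lee_fin ler_wpM2l// f_nd.
have lim2 : \int[P]_w (f_ k (Y w))%:E @[k --> \oo] --> \int[P]_w (h (Y w))%:E.
  have -> : \int[P]_w (h (Y w))%:E = \int[P]_w limn (fun k => (f_ k (Y w))%:E).
    by apply: eq_integral => w _; apply/esym/cvg_lim.
  apply: cvg_monotone_convergence => //.
  - by move=> k; exact/measurable_EFinP.
  - by move=> k w _; rewrite lee_fin.
  - by move=> w _ k m km; rewrite lee_fin f_nd.
rewrite (funext simple) in lim1.
by apply: (cvg_unique _ lim1); [exact: ereal_hausdorff|exact: cvgeZl].
Qed.
End Factorization.

Section IndependentProduct.
Local Open Scope ereal_scope.
Context (R : realType) (d : measure_display) (T : measurableType d)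
  (P : probability T R) (n : nat) (I : finType).
Variable Xs : I -> {RV P >-> borelRn R n}.
Hypothesis indep : mutually_independent Xs.

Lemma integral_prod_independent (g : I -> borelRn R n -> R) :
  (forall i, measurable_fun setT (g i)) -> (forall i x, 0 <= g i x)%R ->
  (forall i, \int[P]_w (g i (Xs i w))%:E < +oo) ->
  \int[P]_w (\prod_i g i (Xs i w))%:E = \prod_i \int[P]_w (g i (Xs i w))%:E.
Proof.
move=> mg g0 goo.
have mX i : measurable_fun setT (Xs i) by exact: measurable_funP.
(* Induction on a list [s] of the indices whose function may fail to be an indicator. When [s] is
   empty the product is the indicator of an intersection of events, and the claim is independence
   itself. *)
suff main (s : seq I) (f : I -> borelRn R n -> R) :
    (forall i, measurable_fun setT (f i)) -> (forall i x, 0 <= f i x)%R ->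
    (forall i, \int[P]_w (f i (Xs i w))%:E < +oo) ->
    (forall i, i \notin s -> exists2 B, measurable B & f i = \1_B) ->
  \int[P]_w (\prod_i f i (Xs i w))%:E = \prod_i \int[P]_w (f i (Xs i w))%:E.
  by apply: (main (enum I)) => // i; rewrite mem_enum.
elim: s f => [f mf f0 foo f1|a s ih f mf f0 foo f1].
  have {}f1 i := f1 i isT.
  pose B i := s2val (cid2 (f1 i)).
  have mB i : measurable (B i) by rewrite /B; case: cid2.
  have fB i : f i = \1_(B i) by rewrite /B; case: cid2.
  have mXB i : measurable (Xs i @^-1` B i).
    by rewrite -[X in measurable X]setTI; exact: mX.
  set E := [set w | forall i, i \in [set: I]%SET -> B i (Xs i w)].
  have mE : measurable E.
    rewrite (_ : E = \bigcap_(i in [set: I]) (Xs i @^-1` B i)).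
      exact: fin_bigcap_measurable.
    by apply/seteqP; split=> w /= h i _; apply: h; rewrite // inE.
  transitivity (\int[P]_w (\1_E w)%:E).
    apply: eq_integral => w _; congr EFin; rewrite indicE.
    have [Ew|nEw] := pselect (E w).
      rewrite mem_set// big1// => i _; rewrite fB indicE mem_set//.
      by apply: Ew; rewrite inE.
    rewrite memNset//; have [i nB] : exists i, ~ B i (Xs i w).
      by apply: contra_notP nEw => /forallNP h i _; exact: contrapT.
    by rewrite (bigD1 i)//= fB indicE memNset// mul0r.
  rewrite integral_indic// setIT.
  apply: (etrans (indep [set: I]%SET mB)).
  apply: eq_big => [i|i _]; first by rewrite inE.
  rewrite fB (eq_integral (fun w => (\1_(Xs i @^-1` B i) w)%:E))//.
  by rewrite integral_indic// setIT.
have [as_|nas] := boolP (a \in s).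
  apply: ih => // i ins; apply: f1; rewrite inE negb_or ins andbT.
  by apply: contraNneq ins => ->.
pose W w := (\prod_(i | i != a) f i (Xs i w))%R.
pose c := fine (\prod_(i | i != a) \int[P]_w (f i (Xs i w))%:E).
have int0 i : 0 <= \int[P]_w (f i (Xs i w))%:E.
  by apply: integral_ge0 => w _; rewrite lee_fin.
have cE : c%:E = \prod_(i | i != a) \int[P]_w (f i (Xs i w))%:E.
  by rewrite fineK//; apply: prode_fin_num => i _; rewrite ge0_fin_numE.
have c0 : (0 <= c)%R by rewrite -lee_fin cE; apply: prode_ge0.
rewrite [RHS](bigD1 a)//= -cE muleC.
under eq_integral do rewrite (bigD1 a)//= mulrC.
apply: (ge0_integral_factor (W := W)) => //.
- rewrite /W; under eq_fun do rewrite -big_filter.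
  apply: measurable_prod => i _.
  exact: (measurableT_comp (mf i) (mX i)).
- by move=> w; apply: prodr_ge0 => i _.
move=> B mB.
(* With the function at [a] replaced by an indicator, [a] leaves the list and the induction
   hypothesis applies; this is the premise on [B] of [ge0_integral_factor]. *)
pose f' i := if i == a then \1_B : borelRn R n -> R else f i.
have f'a : f' a = \1_B by rewrite /f' eqxx.
have f'N i : i != a -> f' i = f i by rewrite /f' => /negbTE ->.
have := ih f'; rewrite (bigD1 a)//= f'a.
under [X in _ * X]eq_bigr => i ia do rewrite f'N//.
rewrite -cE muleC => <-.
- apply: eq_integral => w _; rewrite (bigD1 a)//= f'a mulrC.
  by congr (_ * _)%:E; apply: eq_bigr => i ia; rewrite f'N.
- by move=> i; rewrite /f'; case: ifP => // _; exact: measurable_indic.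
- by move=> i x; rewrite /f'; case: ifP => // _; rewrite indicE.
- move=> i; rewrite /f'; case: ifP => // _.
  rewrite (@le_lt_trans _ _ (\int[P]_w (cst 1 w)))//.
    apply: ge0_le_integral => //.
    + apply/measurable_EFinP.
      exact: (measurableT_comp (measurable_indic mB) (mX i)).
    + by move=> w _; rewrite lee_fin indicE; case: (_ \in _).
  by rewrite integral_cst// mul1e (le_lt_trans (probability_le1 _ _))// ltry.
- move=> i ins; rewrite /f'; case: ifPn => [_|ia]; first by exists B.
  by apply: f1; rewrite inE negb_or ia.
Qed.

End IndependentProduct.

(** * Exponential moments of squares of sub-gaussian variables *)

Section RealBounds.
Context (R : realType).
Implicit Types x : R.

Lemma exprn_fact_le_expR x k : 0 <= x -> x ^+ k / k`!%:R <= expR x.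
Proof.
move=> x0; have nd : nondecreasing_seq (series (exp_coeff x)).
  apply/nondecreasing_seqP => m.
  by rewrite -subr_ge0 seriesEnat /= big_nat_recr//= addrAC subrr add0r exp_coeff_ge0.
have := nondecreasing_cvgn_le nd (is_cvg_series_exp_coeff x) k.+1.
apply: le_trans; rewrite seriesEnat /= big_nat_recr//= lerDr.
by apply: sumr_ge0 => i _; exact: exp_coeff_ge0.
Qed.

Lemma expR1_le4 : expR 1 <= 4 :> R.
Proof.
have h := expR_ge1Dx (- 2^-1 : R).
have -> : expR 1 = (expR (- 2^-1) ^+ 2)^-1 :> R.
  by rewrite -expRM_natl -expRN; congr expR; field.
rewrite -[4]invrK lef_pV2 ?posrE ?exprn_gt0 ?expR_gt0//.
have {}h : 2^-1 <= expR (- 2^-1) :> R by lra.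
have : 2^-1 ^+ 2 <= expR (- 2^-1) ^+ 2 :> R by rewrite lerXn2r ?nnegrE ?expR_ge0.
by apply: le_trans; lra.
Qed.

(** A crude form of Stirling's bound: it turns moments of order (2 k L^2)^k, divided by k!, into the
    terms of a geometric series. *)
Lemma natr_expn_fact_le k : k%:R ^+ k / k`!%:R <= 4 ^+ k :> R.
Proof.
rewrite (le_trans (exprn_fact_le_expR k (ler0n R k)))//.
by rewrite -(mulr1 k%:R) expRM_natl lerXn2r ?nnegrE ?expR_ge0 ?expR1_le4.
Qed.

(** Because exp x >= 1 + x and (1 - x + x^2) (1 + x) = 1 + x^3 >= 1. *)
Lemma expRN_le x : 0 <= x -> expR (- x) <= 1 - x + x ^+ 2.
Proof.
move=> x0; have p : 0 < 1 - x + x ^+ 2 by have := sqr_ge0 (x - 2^-1); lra.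
rewrite expRN -[leRHS]invrK lef_pV2 ?posrE ?expR_gt0 ?invr_gt0//.
rewrite (le_trans _ (expR_ge1Dx x))// -[leLHS]mul1r ler_pdivrMr//.
have : 0 <= x ^+ 3 by rewrite exprn_ge0.
by move=> x3; rewrite -subr_ge0 [leRHS](_ : _ = x ^+ 3)//; ring.
Qed.

End RealBounds.

Section ExponentialMoments.
Local Open Scope ereal_scope.
Context (R : realType) (d : measure_display) (T : measurableType d)
  (P : probability T R).
Variables (Z : T -> R) (L s : R).
Hypothesis mZ : measurable_fun setT Z.
Hypothesis momZ : forall k, (0 < k)%N ->
  \int[P]_w (Z w ^+ (2 * k))%:E <= (((2 * k)%:R * L ^+ 2) ^+ k)%:E.
Hypothesis Zs : \int[P]_w (Z w ^+ 2)%:E = s%:E.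

(** The exponential series is integrated term by term. The term of order 1 is kept exact, so that
    centering can cancel it; those of order k >= 2 are at most q^k with q = 8 l L^2 <= 1/2, and
    their sum is at most 2 q^2 = 128 l^2 L^4. *)
Lemma integral_expR_sqr_le (l : R) : (0 <= l)%R -> (16 * l * L ^+ 2 <= 1)%R ->
  \int[P]_w (expR (l * Z w ^+ 2))%:E <= (1 + l * s + 128 * l ^+ 2 * L ^+ 4)%:E.
Proof.
move=> l0 lL; set q := (8 * l * L ^+ 2)%R.
have q0 : (0 <= q)%R by rewrite mulr_ge0 ?sqr_ge0// mulr_ge0.
have u0 w : (0 <= l * Z w ^+ 2)%R by rewrite mulr_ge0// sqr_ge0.
have mu k : measurable_fun setT (fun w => exp_coeff (l * Z w ^+ 2)%R k).
  rewrite /exp_coeff /=; apply: measurable_funM => //; apply: measurable_funX.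
  by apply: measurable_funM => //; apply: measurable_funX.
have term k : \int[P]_w (exp_coeff (l * Z w ^+ 2) k)%:E =
    (l ^+ k / k`!%:R)%:E * \int[P]_w (Z w ^+ (2 * k))%:E.
  rewrite -ge0_integralZl_EFin//.
  - by apply: eq_integral => w _; rewrite -EFinM /exp_coeff/= exprMn exprM mulrAC.
  - by move=> w _; rewrite lee_fin exprM exprn_ge0// sqr_ge0.
  - by apply/measurable_EFinP/measurable_funX.
  - by rewrite divr_ge0// exprn_ge0.
pose b k : R := (if k is k'.+2 then q ^+ k else if k is 1%N then l * s else 1)%R.
have termb k : \int[P]_w (exp_coeff (l * Z w ^+ 2) k)%:E <= (b k)%:E.
  rewrite term; case: k => [|[|k]].
  - rewrite muln0 expr0 fact0 divr1 mul1e.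
    under eq_integral do rewrite expr0.
    by rewrite integral_cst// mul1e probability_le1.
  - by rewrite muln1 expr1 divr1 Zs.
  rewrite (le_trans (lee_wpmul2l _ (momZ _)))//.
    by rewrite lee_fin divr_ge0// exprn_ge0.
  rewrite -EFinM lee_fin /b; set K := k.+2.
  have -> : (l ^+ K / K`!%:R * ((2 * K)%:R * L ^+ 2) ^+ K =
      (2 * l * L ^+ 2) ^+ K * (K%:R ^+ K / K`!%:R))%R.
    by rewrite natrM !exprMn; ring.
  rewrite (_ : q = 2 * l * L ^+ 2 * 4)%R; last by rewrite /q; ring.
  rewrite [leRHS]exprMn ler_wpM2l// ?natr_expn_fact_le//.
  by rewrite exprn_ge0// mulr_ge0 ?sqr_ge0// mulr_ge0.
have q2 : (q <= 2^-1)%R by rewrite /q; lra.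
have sumb m : (\sum_(k < m) b k <= 1 + l * s + 128 * l ^+ 2 * L ^+ 4)%R.
  have s0 : (0 <= s)%R.
    by rewrite -lee_fin -Zs; apply: integral_ge0 => w _; rewrite lee_fin sqr_ge0.
  have ls : (0 <= l * s)%R by rewrite mulr_ge0.
  have -> : (128 * l ^+ 2 * L ^+ 4 = 2 * q ^+ 2)%R by rewrite /q; ring.
  have q20 : (0 <= q ^+ 2)%R by exact: sqr_ge0.
  case: m => [|[|m]]; rewrite ?big_ord0 ?big_ord1 /=; [lra|lra|].
  rewrite 2!big_ord_recl /= addrA lerD2l.
  (* The factor 1 - q^m makes the induction go through: its step amounts to 1 <= 2 (1 - q). *)
  suff : (\sum_(i < m) q ^+ i.+2 <= 2 * q ^+ 2 * (1 - q ^+ m))%R.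
    have : (0 <= q ^+ m)%R by rewrite exprn_ge0.
    by move=> h1 h2; apply: le_trans h2 _; nra.
  elim: m => [|m ih]; first by rewrite big_ord0 expr0 subrr mulr0.
  rewrite big_ord_recr/= (le_trans (lerD ih (lexx _)))//.
  have := exprn_ge0 m q0; rewrite !exprS => h.
  have : (0 <= q ^+ 2 * q ^+ m * (1 - 2 * q))%R
    by apply: mulr_ge0; [rewrite mulr_ge0|lra].
  by rewrite expr0 expr2; lra.
have -> : \int[P]_w (expR (l * Z w ^+ 2))%:E =
    \int[P]_w limn (fun m => (series (exp_coeff (l * Z w ^+ 2)%R) m)%:E).
  apply: eq_integral => w _; apply/esym/cvg_lim => //.
  by apply: cvg_EFin; [exact: nearW|exact: is_cvg_series_exp_coeff].
have S0 m w : (0 <= series (exp_coeff (l * Z w ^+ 2)) m)%R.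
  by rewrite seriesEnat; apply: sumr_ge0 => k _; exact: exp_coeff_ge0.
have Snd w : {homo series (exp_coeff (l * Z w ^+ 2)) :
    m1 m2 / (m1 <= m2)%N >-> (m1 <= m2)%R}.
  apply/nondecreasing_seqP => m.
  by rewrite -subr_ge0 seriesEnat /= big_nat_recr//= addrAC subrr add0r exp_coeff_ge0.
have mS m : measurable_fun setT (fun w => (series (exp_coeff (l * Z w ^+ 2)) m)%:E).
  by apply/measurable_EFinP; rewrite /series /=; apply: measurable_sum.
rewrite monotone_convergence//.
- apply: lime_le.
    apply: ereal_nondecreasing_is_cvgn => m1 m2 m12; apply: ge0_le_integral => //.
    + by move=> w _; rewrite lee_fin.
    + by move=> w _; rewrite lee_fin Snd.
  apply: nearW => m; apply: (@le_trans _ _ (\sum_(k < m) b k)%R%:E).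
    rewrite -sumEFin.
    rewrite (eq_integral (fun w => \sum_(k < m) (exp_coeff (l * Z w ^+ 2) k)%:E)).
      rewrite ge0_integral_sum//.
      - by apply: lee_sum => k _; exact: termb.
      - by move=> k; apply/measurable_EFinP; exact: mu.
      - by move=> k w _; rewrite lee_fin exp_coeff_ge0.
    by move=> w _; rewrite seriesEord /= sumEFin.
  by rewrite lee_fin.
- by move=> m w _; rewrite lee_fin.
- by move=> w _ m1 m2 m12; rewrite lee_fin Snd.
Qed.

(** Centering removes the linear term, since 1 + a s + r <= exp (a s + r). For the positive sign the
    expansion is [integral_expR_sqr_le]; for the negative sign [expRN_le] reduces it to the fourth
    moment, at most 16 L^4. *)
Lemma mgf_sqr_le (b : bool) (l : R) : (0 <= l)%R -> (16 * l * L ^+ 2 <= 1)%R ->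
  \int[P]_w (expR ((-1) ^+ b * l * (Z w ^+ 2 - s)))%:E
  <= (expR (128 * l ^+ 2 * L ^+ 4))%:E.
Proof.
move=> l0 lL.
have u0 w : (0 <= l * Z w ^+ 2)%R by rewrite mulr_ge0// sqr_ge0.
have mZ2 : measurable_fun setT (fun w => Z w ^+ 2)%R by exact: measurable_funX.
have mE a : measurable_fun setT (fun w => (expR (a * Z w ^+ 2))%:E).
  have m1 : measurable_fun setT (fun w => a * Z w ^+ 2)%R by exact: measurable_funM.
  by apply/measurable_EFinP; exact: (measurableT_comp (@measurable_expR R) m1).
suff h : \int[P]_w (expR ((-1) ^+ b * l * Z w ^+ 2))%:E
    <= (1 + (-1) ^+ b * l * s + 128 * l ^+ 2 * L ^+ 4)%:E.
  set a := ((-1) ^+ b * l)%R in h *.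
  have -> : \int[P]_w (expR (a * (Z w ^+ 2 - s)))%:E =
      (expR (a * s))^-1%:E * \int[P]_w (expR (a * Z w ^+ 2))%:E.
    rewrite -ge0_integralZl_EFin ?invr_ge0 ?expR_ge0//.
    by apply: eq_integral => w _; rewrite mulrBr expRB mulrC EFinM.
  rewrite (le_trans (lee_wpmul2l _ h))//.
  rewrite -EFinM lee_fin mulrC ler_pdivrMr ?expR_gt0// -expRD.
  by rewrite (le_trans _ (expR_ge1Dx _))// addrA addrAC.
case: b; last by rewrite expr0 mul1r; exact: integral_expR_sqr_le.
rewrite expr1 mulN1r.
(* The term l s is added on the left so that only nonnegative functions are integrated: exp (- l
   Z^2) + l Z^2 <= 1 + l^2 Z^4 pointwise. *)
have h : \int[P]_w (expR (- l * Z w ^+ 2))%:E + (l * s)%:E <=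
    1 + (16 * l ^+ 2 * L ^+ 4)%:E.
  have mom4 := momZ (isT : (0 < 2)%N).
  have int4 : \int[P]_w (1 + (l ^+ 2 * Z w ^+ 4)%:E) <= 1 + (16 * l ^+ 2 * L ^+ 4)%:E.
    rewrite ge0_integralD//; last 2 first.
    - by move=> w _; rewrite lee_fin mulr_ge0// ?sqr_ge0// exprn_even_ge0.
    - by apply/measurable_EFinP/measurable_funM => //; exact: measurable_funX.
    rewrite integral_cst// leeD//; first by rewrite mul1e probability_le1.
    under eq_integral do rewrite EFinM.
    rewrite ge0_integralZl_EFin//; last 3 first.
    - by move=> w _; rewrite lee_fin exprn_even_ge0.
    - by apply/measurable_EFinP; exact: measurable_funX.
    - exact: sqr_ge0.
    rewrite (le_trans (lee_wpmul2l _ mom4))// ?lee_fin ?sqr_ge0//.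
    by rewrite le_eqVlt; apply/orP; left; apply/eqP; rewrite /=; ring.
  apply: le_trans int4; rewrite EFinM -Zs.
  rewrite -ge0_integralZl_EFin//; last 2 first.
  - by move=> w _; rewrite lee_fin sqr_ge0.
  - exact/measurable_EFinP.
  have lZ w : 0 <= l%:E * (Z w ^+ 2)%:E by rewrite -EFinM lee_fin u0.
  rewrite -ge0_integralD//; last by apply/measurable_EFinP/measurable_funM.
  apply: ge0_le_integral => //.
  - by move=> w _; rewrite adde_ge0// lee_fin expR_ge0.
  - by apply: emeasurable_funD => //; exact/measurable_EFinP/measurable_funM.
  - apply: emeasurable_funD => //; apply/measurable_EFinP/measurable_funM => //.
    exact: measurable_funX.
  move=> w _; rewrite -!EFinD lee_fin.
  have /expRN_le := u0 w.
  by rewrite exprMn -exprM mulNr; lra.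
rewrite -(leeD2rE (x := (l * s)%:E))// (le_trans h)// -!EFinD lee_fin.
have : (0 <= l ^+ 2 * L ^+ 4)%R by rewrite mulr_ge0 ?sqr_ge0// exprn_even_ge0.
by lra.
Qed.

End ExponentialMoments.

(** * Measurability and moments of the marginals *)

Section RandomVectors.
Context (R : realType) (n : nat).

Lemma measurable_coord (i : 'I_n) :
  measurable_fun setT (fun v : borelRn R n => (v : 'cV[R]_n) i ord0).
Proof.
apply: (measurability _ (RGenOInfty.measurableE R)).
move=> _ [_ [x ->] <-]; rewrite setTI; apply: sub_sigma_algebra.
apply: open_comp => [v _|]; last exact: interval_open.
exact: coord_continuous.
Qed.

Lemma measurable_dotv (y : 'cV[R]_n) :
  measurable_fun setT (fun v : borelRn R n => dotv (v : 'cV[R]_n) y).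
Proof.
apply: measurable_sum => i; apply: measurable_funM => //.
exact: measurable_coord.
Qed.

End RandomVectors.

Section Moments.
Local Open Scope ereal_scope.
Context (R : realType) (d : measure_display) (T : measurableType d)
  (P : probability T R).

Lemma ge0_le_Lnorm (p : R) (f g : T -> R) : (0 < p)%R ->
  measurable_fun setT f -> measurable_fun setT g ->
  (forall w, `|f w| <= `|g w|)%R ->
  'N[P]_p%:E[EFin \o f] <= 'N[P]_p%:E[EFin \o g].
Proof.
move=> p0 mf mg fg; rewrite unlock; apply: gt0_ler_poweR; rewrite ?invr_ge0 ?(ltW p0)//.
- by rewrite in_itv /= leey andbT integral_ge0// => w _; exact: poweR_ge0.
- by rewrite in_itv /= leey andbT integral_ge0// => w _; exact: poweR_ge0.
have m (h : T -> R) : measurable_fun setT h ->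
    measurable_fun setT (fun x => `|(EFin \o h) x| `^ p).
  move=> mh; apply: (measurableT_comp (measurable_poweR p)) => //.
  apply: measurableT_comp => //; exact/measurable_EFinP.
apply: ge0_le_integral => //.
- by move=> w _; exact: poweR_ge0.
- exact: m.
- exact: m.
- move=> w _; rewrite gt0_ler_poweR ?(ltW p0)// ?in_itv/= ?lee_fin ?normr_ge0 ?leey//.
Qed.

Lemma Lnorm_sum_le (p : R) (I : Type) (s : seq I) (f : I -> T -> R) : (1 <= p)%R ->
  (forall i, measurable_fun setT (f i)) ->
  'N[P]_p%:E[EFin \o (fun w => \sum_(i <- s) f i w)%R] <=
  \sum_(i <- s) 'N[P]_p%:E[EFin \o f i].
Proof.
move=> p1 mf; elim: s => [|i s ih].
  rewrite big_nil (eq_Lnorm _ _ (g := cst 0)) ?Lnorm0//.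
    by rewrite eqe gt_eqF// (lt_le_trans _ p1).
  by move=> w /=; rewrite big_nil.
rewrite big_cons; apply: le_trans (leeD (lexx _) ih).
rewrite (eq_Lnorm _ _ (g := EFin \o (f i \+ (fun w => \sum_(j <- s) f j w))%R)).
  by apply: minkowski_EFin => //; exact: measurable_sum.
by move=> w /=; rewrite big_cons.
Qed.

Lemma psi2_norm_moment (Z : T -> R) (L : R) k :
  measurable_fun setT Z -> (0 <= L)%R -> psi2_norm P Z <= L%:E -> (0 < k)%N ->
  \int[P]_w (Z w ^+ (2 * k))%:E <= (((2 * k)%:R * L ^+ 2) ^+ k)%:E.
Proof.
move=> mZ L0 ZL k0; set p : R := (2 * k)%:R.
have p1 : (1 <= p)%R by rewrite ler1n muln_gt0.
have p0 : (0 < p)%R by exact: lt_le_trans p1.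
have Np : (p `^ (- 2^-1))%R%:E * 'N[P]_p%:E[EFin \o Z] <= L%:E.
  by apply: le_trans ZL; apply: ereal_sup_ubound; exists p.
have {}Np : 'N[P]_p%:E[EFin \o Z] <= (L * p `^ 2^-1)%:E.
  by move: Np; rewrite powRN lee_pdivrMl ?powR_gt0// EFinM muleC.
have -> : \int[P]_w (Z w ^+ (2 * k))%:E = 'N[P]_p%:E[EFin \o Z] `^ p.
  rewrite poweR_Lnorm ?gt_eqF//; apply: eq_integral => w _ /=.
  congr EFin; rewrite powR_mulrn// exprM [RHS]exprM.
  by rewrite real_normK ?num_real.
apply: (@le_trans _ _ ((L * p `^ 2^-1)%:E `^ p)).
  rewrite gt0_ler_poweR ?(ltW p0)// ?in_itv/= ?leey ?andbT ?Lnorm_ge0//.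
  by rewrite lee_fin mulr_ge0// powR_ge0.
rewrite poweR_EFin lee_fin powR_mulrn ?mulr_ge0 ?powR_ge0//.
rewrite powR12_sqrt ?(ltW p0)// [leLHS]exprM.
have -> : ((L * Num.sqrt p) ^+ 2 = L ^+ 2 * p)%R by rewrite exprMn sqr_sqrtr ?(ltW p0).
by rewrite [(p * _)%R]mulrC.
Qed.

End Moments.

Section RandomVectorMoments.
Local Open Scope ereal_scope.
Context (R : realType) (d : measure_display) (T : measurableType d)
  (P : probability T R) (n : nat).
Implicit Type X : {RV P >-> borelRn R n}.

Lemma measurable_RV_coord X i : measurable_fun setT (fun w => (X w : 'cV[R]_n) i ord0).
Proof.
by apply: (measurableT_comp (measurable_coord i)); exact: measurable_funP.
Qed.

Lemma measurable_marginal X y : measurable_fun setT (marginal X y).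
Proof.
by apply: (measurableT_comp (measurable_dotv y)); exact: measurable_funP.
Qed.

Lemma marginal_delta X i w :
  marginal X (delta_mx i ord0) w = (X w : 'cV[R]_n) i ord0.
Proof. exact: dotv_delta. Qed.

(** Sub-gaussianity is assumed one direction at a time, so a uniform bound has to be found: for a
    unit vector x, |<X,x>| is at most the sum of the |X_i|, and Minkowski's inequality bounds the
    supremum by the sum of the norms of the n coordinates. *)
Lemma psi2_norm_vec_lty X : sub_gaussian_vec X -> psi2_norm_vec X < +oo.
Proof.
move=> sgX; pose e i : 'cV[R]_n := delta_mx i ord0.
apply: (@le_lt_trans _ _ (\sum_(i < n) psi2_norm P (marginal X (e i)))); last first.
  by apply: lte_sum_pinfty => i _; exact: sgX.
apply: ge_ereal_sup => _ [x x1 <-]; apply: ge_ereal_sup => _ [p /= p1 <-].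
have p0 : (0 < p)%R by exact: lt_le_trans p1.
apply: (@le_trans _ _ ((p `^ (- 2^-1))%R%:E *
    \sum_(i < n) 'N[P]_p%:E[EFin \o marginal X (e i)])).
  apply: lee_wpmul2l; first by rewrite lee_fin powR_ge0.
  apply: (@le_trans _ _ 'N[P]_p%:E[EFin \o (fun w =>
     \sum_(i < n) `|marginal X (e i) w|)%R]).
    apply: ge0_le_Lnorm => //; first exact: measurable_marginal.
      apply: measurable_sum => i; apply: measurableT_comp => //.
      exact: measurable_marginal.
    move=> w; rewrite [leRHS]ger0_norm ?sumr_ge0//.
    rewrite (le_trans (ler_norm_sum _ _ _))// ler_sum// => i _.
    rewrite marginal_delta normrM -[leRHS]mulr1 ler_wpM2l//.
    by rewrite -x1 normr_coord_le_l2norm.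
  rewrite (le_trans (Lnorm_sum_le _ _ _ _))//.
    move=> i; apply: measurableT_comp => //; exact: measurable_marginal.
  by apply: lee_sum => i _; rewrite -[leRHS]Lnorm_abse.
rewrite ge0_sume_distrr; last by move=> i _; exact: Lnorm_ge0.
by apply: lee_sum => i _; apply: ereal_sup_ubound; exists p.
Qed.

(** Formulated on the ball because net points need not have length 1; normalizing a nonzero y can
    only increase the even moments. *)
Lemma marginal_moment X (L : R) (y : 'cV[R]_n) k :
  (0 <= L)%R -> psi2_norm_vec X <= L%:E -> (l2norm y <= 1)%R -> (0 < k)%N ->
  \int[P]_w (marginal X y w ^+ (2 * k))%:E <= (((2 * k)%:R * L ^+ 2) ^+ k)%:E.
Proof.
move=> L0 XL y1 k0; have [->|y0] := eqVneq y 0%R.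
  rewrite (eq_integral (cst 0)); last first.
    move=> w _; rewrite /marginal dotvC -(scale0r 0) dotvZl mul0r expr0n.
    by rewrite muln_eq0 (gtn_eqF k0).
  by rewrite integral0 lee_fin exprn_ge0// mulr_ge0// sqr_ge0.
set u := ((l2norm y)^-1 *: y)%R.
have yu : y = (l2norm y *: u)%R.
  by rewrite scalerA mulfV ?l2norm_eq0// scale1r.
apply: (@le_trans _ _ (\int[P]_w (marginal X u w ^+ (2 * k))%:E)); last first.
  apply: psi2_norm_moment => //; first exact: measurable_marginal.
  apply: le_trans XL; apply: ereal_sup_ubound; exists u => //.
  exact: l2norm_normalize.
apply: ge0_le_integral => //.
- by move=> w _; rewrite lee_fin exprM exprn_ge0// sqr_ge0.
- by apply/measurable_EFinP/measurable_funX; exact: measurable_marginal.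
- by apply/measurable_EFinP/measurable_funX; exact: measurable_marginal.
- move=> w _; rewrite lee_fin {1}yu /marginal dotvZr exprMn -[leRHS]mul1r.
  rewrite ler_wpM2r ?exprn_ile1 ?l2norm_ge0//.
  by rewrite exprM exprn_ge0// sqr_ge0.
Qed.

Lemma integral_sum_integrable (I : Type) (s : seq I) (f : I -> T -> \bar R) :
  (forall i, P.-integrable setT (f i)) ->
  \int[P]_w (\sum_(i <- s) f i w) = \sum_(i <- s) \int[P]_w f i w.
Proof.
move=> intf; elim: s => [|i s ih].
  by rewrite big_nil; under eq_integral do rewrite big_nil; exact: integral0.
under eq_integral do rewrite big_cons.
rewrite big_cons -ih integralD//; exact: integrable_sum.
Qed.

(** The moment bound makes squares of coordinates integrable, hence also their products; so [fine]
    in [covariance_mx] returns true expectations, and the identity follows by expanding the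
    square. *)
Lemma integral_marginal_sqr X (L : R) (y : 'cV[R]_n) :
  (0 <= L)%R -> psi2_norm_vec X <= L%:E ->
  \int[P]_w (marginal X y w ^+ 2)%:E = (dotv (covariance_mx X *m y) y)%:E.
Proof.
move=> L0 XL; pose c w i := (X w : 'cV[R]_n) i ord0.
have mc i : measurable_fun setT (c ^~ i) by exact: measurable_RV_coord.
have int2 i : P.-integrable setT (fun w => (c w i ^+ 2)%:E).
  apply/integrableP; split; first exact/measurable_EFinP/measurable_funX.
  have d1 : (l2norm (delta_mx i ord0 : 'cV[R]_n) <= 1)%R by rewrite l2norm_delta.
  apply: le_lt_trans (le_lt_trans (marginal_moment L0 XL d1 (isT : (0 < 1)%N)) (ltry _)).
  rewrite le_eqVlt; apply/orP; left; apply/eqP; apply: eq_integral => w _.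
  by rewrite marginal_delta muln1 gee0_abs// lee_fin sqr_ge0.
have intc i j : P.-integrable setT (fun w => (c w i * c w j)%:E).
  apply: (@le_integrable _ _ _ _ _ _ _ (fun w => (c w i ^+ 2 + c w j ^+ 2)%:E)) => //.
  - by apply/measurable_EFinP/measurable_funM.
  - move=> w _; rewrite lee_fin [leRHS]ger0_norm ?addr_ge0 ?sqr_ge0//.
    rewrite ler_norml; apply/andP; split.
      have := sqr_ge0 (c w i + c w j); have := sqr_ge0 (c w i - c w j).
      by rewrite sqrrB sqrrD; have := sqr_ge0 (c w i); have := sqr_ge0 (c w j); lra.
    have := sqr_ge0 (c w i + c w j); have := sqr_ge0 (c w i - c w j).
    by rewrite sqrrB sqrrD; have := sqr_ge0 (c w i); have := sqr_ge0 (c w j); lra.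
  - under eq_fun do rewrite EFinD; exact: integrableD.
have covE i j : \int[P]_w (c w i * c w j)%:E = (covariance_mx X i j)%:E.
  rewrite mxE fineK.
    rewrite unlock; apply: eq_integral => w _ /=.
    by rewrite /outer mxE big_ord1 mxE.
  rewrite unlock; under eq_integral do rewrite /= /outer mxE big_ord1 mxE.
  exact: (integrable_fin_num measurableT (intc i j)).
have -> : (dotv (covariance_mx X *m y) y)%:E =
    \sum_(i < n) \sum_(j < n) (y i ord0 * y j ord0)%:E * (covariance_mx X i j)%:E.
  rewrite /dotv -sumEFin; apply: eq_bigr => i _; rewrite mxE mulr_suml -sumEFin.
  by apply: eq_bigr => j _; rewrite -EFinM; congr EFin; ring.
have intyc i j : P.-integrable setT
    (fun w => (y i ord0 * y j ord0)%:E * (c w i * c w j)%:E).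
  exact: integrableZl.
under [RHS]eq_bigr => i _ do under eq_bigr => j _ do rewrite -covE -integralZl//.
under [RHS]eq_bigr => i _ do rewrite -integral_sum_integrable//.
rewrite -integral_sum_integrable; last by move=> i; exact: integrable_sum.
apply: eq_integral => w _; rewrite /marginal /dotv expr2 mulr_suml -sumEFin.
apply: eq_bigr => i _; rewrite mulr_sumr -sumEFin; apply: eq_bigr => j _.
by rewrite -EFinM; congr EFin; rewrite /c; ring.
Qed.

End RandomVectorMoments.

(** * Concentration of the sample covariance *)

Section SampleCovariance.
Context (R : realType).

Lemma outer_mulmx n (x y : 'cV[R]_n) : outer x *m y = dotv x y *: x.
Proof.
rewrite /outer -mulmxA; apply/matrixP => i j; rewrite !mxE big_ord1 mxE mulrC.
by rewrite (ord1 j); congr (_ * _); apply: eq_bigr => k _; rewrite mxE.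
Qed.

Lemma dotv_sample_covariance n (d : measure_display) (T : measurableType d)
    (P : probability T R) N (Xs : 'I_N -> {RV P >-> borelRn R n})
    (S : 'M[R]_n) (y : 'cV[R]_n) w : (0 < N)%N ->
  dotv ((sample_covariance_mx Xs w - S) *m y) y =
  N%:R^-1 * \sum_(i < N) (marginal (Xs i) y w ^+ 2 - dotv (S *m y) y).
Proof.
move=> N0; rewrite mulmxBl dotvDl dotvNl -scalemxAl dotvZl mulmx_suml.
rewrite big_split /= sumr_const card_ord mulrDr mulNrn mulrN -[dotv _ _ *+ _]mulr_natl.
rewrite mulrA mulVf ?pnatr_eq0 -?lt0n// mul1r; congr (_ * _ - _).
have dotv_sum (I : Type) (s : seq I) (F : I -> 'cV[R]_n) :
    dotv (\sum_(i <- s) F i) y = \sum_(i <- s) dotv (F i) y.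
  elim: s => [|i s ih]; last by rewrite !big_cons dotvDl ih.
  by rewrite !big_nil -(scale0r 0) dotvZl mul0r.
by rewrite dotv_sum; apply: eq_bigr => i _; rewrite outer_mulmx dotvZl expr2.
Qed.

Lemma sample_covariance_sym n (d d0 : measure_display) (T : measurableType d)
    (T0 : measurableType d0) (P : probability T R) (P0 : probability T0 R)
    N (Xs : 'I_N -> {RV P >-> borelRn R n}) (X : {RV P0 >-> borelRn R n}) w :
  (sample_covariance_mx Xs w - covariance_mx X)^T =
  sample_covariance_mx Xs w - covariance_mx X.
Proof.
have outerC (x : 'cV[R]_n) i j : outer x i j = outer x j i.
  by rewrite /outer !mxE !big_ord1 !mxE mulrC.
apply/matrixP => i j; rewrite !mxE !summxE; congr (_ * _ - fine _).
  by apply: eq_bigr => k _; exact: outerC.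
by congr expectation; apply/funext => v; exact: outerC.
Qed.

Lemma measurable_spectral_norm_le n (d : measure_display) (T : measurableType d)
    (M : T -> 'M[R]_n) (e : R) : (0 < n)%N -> 0 <= e ->
  (forall i j, measurable_fun setT (fun w => M w i j)) ->
  measurable [set w | spectral_norm (M w) <= e].
Proof.
move=> n0 e0 mM.
have -> : [set w | spectral_norm (M w) <= e] =
    \bigcap_m \bigcap_(g in [set: {ffun 'I_n -> bool * 'I_m}])
      [set w | l2norm (M w *m latv R g) <= e * l2norm (latv R g)].
  apply/seteqP; split => w /=.
    by move/(spectral_norm_le_latv _ n0 e0) => h m _ g _; exact: h.
  move=> h; apply/(spectral_norm_le_latv _ n0 e0) => m g; exact: h.
apply: bigcapT_measurable => m; apply: fin_bigcap_measurable => // g _.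
set c := e * _; have c0 : 0 <= c by rewrite mulr_ge0// l2norm_ge0.
have mf i : measurable_fun setT (fun w => (M w *m latv R g) i ord0).
  under eq_fun do rewrite mxE.
  by apply: measurable_sum => j; exact: measurable_funM.
have mdot : measurable_fun setT
    (fun w => dotv (M w *m latv R g) (M w *m latv R g)).
  by apply: measurable_sum => j; exact: measurable_funM.
rewrite [X in measurable X](_ : _ =
    (fun w => dotv (M w *m latv R g) (M w *m latv R g)) @^-1` `]-oo, c ^+ 2]).
  by rewrite -[X in measurable X]setTI; apply: mdot => //; exact: measurable_itv.
apply/seteqP; split => w /=; rewrite in_itv /= -sqr_l2norm;
  by rewrite ler_pXn2r// nnegrE ?l2norm_ge0.
Qed.

End SampleCovariance.

Lemma measure_bigsetU_le d (T : measurableType d) (R : realType)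
    (mu : {measure set T -> \bar R}) (I : Type) (s : seq I) (p : pred I)
    (A : I -> set T) : (forall i, measurable (A i)) ->
  (mu (\big[setU/set0]_(i <- s | p i) A i) <= \sum_(i <- s | p i) mu (A i))%E.
Proof.
move=> mA; elim: s => [|i s ih]; first by rewrite !big_nil measure0.
rewrite !big_cons; case: ifP => // _.
apply: le_trans (leeD (lexx _) ih); apply: measureU2 => //.
exact: bigsetU_measurable.
Qed.

Lemma measurable_sum_sqr_marginal_ge (R : realType) n (d : measure_display)
    (T : measurableType d) (P : probability T R) N
    (Xs : 'I_N -> {RV P >-> borelRn R n}) (y : 'cV[R]_n) (b : bool) (s a : R) :
  measurable [set w | a <= (-1) ^+ b *
    \sum_(i < N) (marginal (Xs i) y w ^+ 2 - s)].
Proof.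
have mS : measurable_fun setT (fun w =>
    (-1) ^+ b * \sum_(i < N) (marginal (Xs i) y w ^+ 2 - s)).
  apply: measurable_funM => //; apply: measurable_sum => i.
  apply: measurable_funB => //; apply: measurable_funX.
  exact: measurable_marginal.
rewrite [X in measurable X](_ : _ = (fun w =>
    (-1) ^+ b * \sum_(i < N) (marginal (Xs i) y w ^+ 2 - s)) @^-1` `[a, +oo[).
  by rewrite -[X in measurable X]setTI; apply: mS => //; exact: measurable_itv.
by apply/seteqP; split => w /=; rewrite in_itv /= andbT.
Qed.

Section Concentration.
Local Open Scope ereal_scope.
Context (R : realType) (n : nat) (d0 d : measure_display)
  (T0 : measurableType d0) (T : measurableType d)
  (P0 : probability T0 R) (P : probability T R).
Variables (X : {RV P0 >-> borelRn R n}) (N : nat)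
  (Xs : 'I_N -> {RV P >-> borelRn R n}) (L : R).
Hypothesis L1 : (1 <= L)%R.
Hypothesis XL : psi2_norm_vec X <= L%:E.
Hypothesis indep : mutually_independent Xs.
Hypothesis same : forall i, same_distribution (Xs i) X.

Let L0 : (0 <= L)%R. Proof. exact: le_trans L1. Qed.

Lemma ge0_integral_same_distribution i (g : borelRn R n -> R) :
  measurable_fun setT g -> (forall v, 0 <= g v)%R ->
  \int[P]_w (g (Xs i w))%:E = \int[P0]_w (g (X w))%:E.
Proof.
move=> mg g0; have mgE : measurable_fun setT (EFin \o g) by exact/measurable_EFinP.
rewrite -[LHS](ge0_integral_distribution (Xs i) mgE)//.
rewrite -[RHS](ge0_integral_distribution X mgE)//.
by apply: eq_measure_integral => B mB _; exact: same.
Qed.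

Lemma sample_covariance_tail (y : 'cV[R]_n) (b : bool) (e : R) :
  (l2norm y <= 1)%R -> (0 < e <= 1)%R ->
  P [set w | (N%:R * e <= (-1) ^+ b *
       \sum_(i < N) (marginal (Xs i) y w ^+ 2 - dotv (covariance_mx X *m y) y))%R]
  <= (expR (- (e ^+ 2 * N%:R / (512 * L ^+ 4))))%:E.
Proof.
move=> y1 /andP[e0 e1]; set s := dotv (covariance_mx X *m y) y.
(* This [l] minimizes 128 l^2 L^4 - l e, with minimum - e^2 / (512 L^4). It is admissible for
   [mgf_sqr_le] because 16 l L^2 = e / (16 L^2) <= 1, by e <= 1 <= L. *)
set A := [set w | _]; pose l : R := (e / (256 * L ^+ 4))%R.
have Lp : (0 < L)%R by exact: lt_le_trans L1.
have L2 : (0 < L ^+ 2)%R by rewrite exprn_gt0// (lt_le_trans _ L1).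
have L21 : (1 <= L ^+ 2)%R by rewrite exprn_ege1.
have L4 : (0 < L ^+ 4)%R by rewrite exprn_gt0// (lt_le_trans _ L1).
have l0 : (0 <= l)%R by rewrite divr_ge0 ?mulr_ge0// ltW.
have lL : (16 * l * L ^+ 2 <= 1)%R.
  rewrite (_ : 16 * l * L ^+ 2 = e / (16 * L ^+ 2))%R; last first.
    by rewrite /l; field; rewrite gt_eqF// (lt_le_trans _ L1).
  by rewrite ler_pdivrMr ?mulr_gt0//; lra.
pose g (v : borelRn R n) := expR ((-1) ^+ b * l * (dotv (v : 'cV[R]_n) y ^+ 2 - s)).
have mg : measurable_fun setT g.
  apply: measurableT_comp => //; apply: measurable_funM => //.
  apply: measurable_funB => //; apply: measurable_funX; exact: measurable_dotv.
have gX i : \int[P]_w (g (Xs i w))%:E <= (expR (128 * l ^+ 2 * L ^+ 4))%:E.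
  rewrite ge0_integral_same_distribution//; last by move=> v; exact: expR_ge0.
  apply: (mgf_sqr_le (Z := marginal X y)) => //.
  - exact: measurable_marginal.
  - by move=> k k0; exact: marginal_moment.
  - exact: (integral_marginal_sqr _ L0).
have mA : measurable A by exact: measurable_sum_sqr_marginal_ge.
have prodE w : (\prod_i g (Xs i w) = expR (l * ((-1) ^+ b *
    \sum_(i < N) (marginal (Xs i) y w ^+ 2 - s))))%R.
  by rewrite -expR_sum -mulr_sumr; congr expR; rewrite [RHS]mulrCA [RHS]mulrA.
have mprod : measurable_fun setT (fun w => \prod_i g (Xs i w))%R.
  apply: measurable_prod => i _; apply: (measurableT_comp mg).
  exact: measurable_funP.
apply: (@le_trans _ _ ((expR (- (l * (N%:R * e))))%:E *
    \int[P]_w (\prod_i g (Xs i w))%:E)).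
  rewrite -[A]setIT -integral_indic// -ge0_integralZl_EFin ?expR_ge0//; last 2 first.
  - by move=> w _; rewrite lee_fin prodE expR_ge0.
  - exact/measurable_EFinP.
  apply: ge0_le_integral => //.
  - exact/measurable_EFinP/measurable_indic.
  - by apply/measurable_EFinP/measurable_funM.
  move=> w _; rewrite -EFinM lee_fin prodE -expRD indicE.
  have [wA|_] := boolP (w \in A); last exact: expR_ge0.
  apply: (@le_trans _ _ (expR 0)%R); first by rewrite expR0.
  by rewrite ler_expR addrC subr_ge0 ler_wpM2l//; move: wA; rewrite inE.
rewrite (integral_prod_independent indep (g := fun=> g))//; last first.
- by move=> i; rewrite (le_lt_trans (gX i))// ltry.
- by move=> i v; exact: expR_ge0.
apply: (@le_trans _ _ ((expR (- (l * (N%:R * e))))%:E *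
    (expR (128 * l ^+ 2 * L ^+ 4) ^+ N)%:E)).
  rewrite lee_wpmul2l ?lee_fin ?expR_ge0//.
  rewrite -[N in leRHS]card_ord -prodr_const -prodEFin.
  (* Nonnegativity is carried along because inequalities between extended reals multiply only with
     it. *)
  pose r (x z : \bar R) := 0 <= x /\ x <= z.
  suff [] : r (\prod_i \int[P]_w (g (Xs i w))%:E)
      (\prod_(i < N) (expR (128 * l ^+ 2 * L ^+ 4))%:E) by [].
  apply: (big_ind2 r) => [|x1 x2 z1 z2 [x10 x12] [z10 z12]|i _].
  - by split.
  - by split; [exact: mule_ge0|exact: lee_pmul].
  - by split => //; apply: integral_ge0 => w _; rewrite lee_fin expR_ge0.
rewrite -EFinM lee_fin -expRM_natl -expRD ler_expR le_eqVlt.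
apply/orP; left; apply/eqP; rewrite /l; field.
by rewrite gt_eqF// (lt_le_trans _ L1).
Qed.
End Concentration.

Theorem corollary5p50 (R : realType) :
  exists C : \bar R -> R,
    (forall K : \bar R, 0 < C K) /\
    forall (n : nat), (0 < n)%N ->
    forall (d0 : measure_display) (T0 : measurableType d0)
      (P0 : probability T0 R) (X : {RV P0 >-> borelRn R n}),
      centered X -> sub_gaussian_vec X ->
    forall (N : nat) (d : measure_display) (T : measurableType d)
      (P : probability T R) (Xs : 'I_N -> {RV P >-> borelRn R n}),
      mutually_independent Xs ->
      (forall i, same_distribution (Xs i) X) ->
    forall eps t : R, 0 < eps < 1 -> 1 <= t ->
      C (psi2_norm_vec X) * (t / eps) ^+ 2 * n%:R <= N%:R ->
      ((1 - 2 * expR (- (t ^+ 2 * n%:R)))%R%:E <=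
         P [set w | (spectral_norm
                       (sample_covariance_mx Xs w - covariance_mx X)
                     <= eps)%R])%E.
Proof.
(* The maximum with 1 makes [C K] positive for every extended real K, including the infinite ones,
   where [fine] is 0, and gives the bound 1 <= L used by the tail estimate. *)
pose Lc (K : \bar R) : R := Num.max 1 (fine K).
(* 19 = 18 + 1: exp (18 n) bounds the size of the net, exp (- t^2 n) is the target. *)
exists (fun K => 19 * 2 ^+ 11 * Lc K ^+ 4); split.
  by move=> K; rewrite mulr_gt0 ?mulr_gt0 ?exprn_gt0// lt_max ltr01.
move=> n n0 d0 T0 P0 X _ sgX N d T P Xs indep same eps t /andP[eps0 eps1] t1 NC.
set L := Lc (psi2_norm_vec X) in NC; pose S := covariance_mx X.
have L1 : 1 <= L by rewrite le_max lexx.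
have tp : 0 < t by exact: lt_le_trans t1.
have Lp : 0 < L by exact: lt_le_trans L1.
have XL : (psi2_norm_vec X <= L%:E)%E.
  have := psi2_norm_vec_lty sgX; rewrite /L /Lc.
  case: (psi2_norm_vec X) => [r _|//|_]; last exact: leNye.
  by rewrite lee_fin /= le_max lexx orbT.
have n0R : 0 < n%:R :> R by rewrite ltr0n.
have N0 : (0 < N)%N.
  rewrite -(ltr_nat R); apply: lt_le_trans NC.
  apply: mulr_gt0 => //; apply: mulr_gt0; last by rewrite exprn_gt0 ?divr_gt0.
  by rewrite mulr_gt0 ?mulr_gt0 ?exprn_gt0.
have N0R : 0 < N%:R :> R by rewrite ltr0n.
(* The boolean is the sign of the deviation: the two one-sided tails account for the factor 2 in the
   probability. *)
pose I : finType := ({ffun 'I_n -> bool * 'I_(4 * n).+1} * bool)%type.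
pose y (g : {ffun 'I_n -> bool * 'I_(4 * n).+1}) : 'cV[R]_n :=
  (4 * Num.sqrt n%:R)^-1 *: latv R g.
(* The unit ball in lattice units: its squared radius is (4 sqrt n)^2 = 16 n. *)
pose valid (g : {ffun 'I_n -> bool * 'I_(4 * n).+1}) :=
  dotv (latv R g) (latv R g) <= 16 * n%:R.
have validE g : valid g = (l2norm (y g) <= 1).
  have s0 : 0 < 4 * Num.sqrt n%:R :> R by rewrite mulr_gt0// sqrtr_gt0.
  rewrite /y l2normZ ger0_norm ?invr_ge0 ?(ltW s0)// mulrC ler_pdivrMr// mul1r.
  rewrite -(ler_pXn2r (ltn0Sn 1)) ?nnegrE ?l2norm_ge0 ?(ltW s0)//.
  rewrite sqr_l2norm exprMn sqr_sqrtr// /valid; congr (_ <= _ * _); ring.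
(* The threshold is [eps / 2] because passing from the net to the norm costs a factor 2. *)
pose bad (p : I) : set T := [set w | N%:R * (eps / 2) <= (-1) ^+ p.2 *
  \sum_(i < N) (marginal (Xs i) (y p.1) w ^+ 2 - dotv (S *m y p.1) (y p.1))].
have mbad p : measurable (bad p) by exact: measurable_sum_sqr_marginal_ge.
set good := [set w | _].
have mgood : measurable good.
  apply: measurable_spectral_norm_le => // [|i j]; first exact: ltW.
  under eq_fun do rewrite mxE [X in X + _]mxE summxE.
  apply: measurable_funD => //; apply: measurable_funM => //.
  apply: measurable_sum => k; under eq_fun do rewrite /outer mxE big_ord1 mxE.
  by apply: measurable_funM; exact: measurable_RV_coord.
pose B := \big[setU/set0]_(p : I | valid p.1) bad p.
have mB : measurable B by exact: bigsetU_measurable.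
have good_bad : ~` good `<=` B.
  move=> w; apply: contra_notP => nB; rewrite /good /=.
  rewrite -[leRHS](_ : 2 * (eps / 2) = _); last by rewrite mulrCA mulfV ?mulr1.
  apply: (@spectral_norm_net_le _ _ _ [set v | exists g, v = y g]) => //.
  - exact: sample_covariance_sym.
  - move=> x x1; have [g [h1 h2]] := latv_net n0 x1.
    by exists (y g); split => //; exists g.
  move=> _ [g ->] g1; have vg : valid g by rewrite validE.
  have nbad b : ~ bad (g, b) w.
    move=> gb; apply: nB; rewrite /B -(bigcup_pred (fun p : I => valid p.1)).
    by exists (g, b).
  rewrite dotv_sample_covariance// mulrC normrM [X in _ * X]ger0_norm ?invr_ge0//.
  rewrite ler_pdivrMr// mulrC ler_norml.
  have := nbad true; have := nbad false; rewrite /bad /= expr0 expr1 mul1r mulN1r.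
  move=> /negP; rewrite -ltNge => /ltW h1 /negP; rewrite -ltNge => /ltW h2.
  by rewrite h1 lerNl h2.
have PB : (P B <= (2 * expR (- (t ^+ 2 * n%:R)))%:E)%E.
  apply: (le_trans (measure_bigsetU_le P _ _ mbad)).
  pose q := expR (- ((eps / 2) ^+ 2 * N%:R / (512 * L ^+ 4))).
  apply: (@le_trans _ _ (\sum_(p : I | valid p.1) q%:E)%E).
    apply: lee_sum => -[g b] /= vg; apply: sample_covariance_tail => //.
      by rewrite -validE.
    by rewrite divr_gt0//=; lra.
  rewrite sumEFin lee_fin.
  have -> : \sum_(p : I | valid p.1) q = \sum_(g | valid g) 1 * (q *+ 2).
    under [RHS]eq_bigr do rewrite mul1r mulr2n -(big_bool _ (fun=> q)).
    by rewrite pair_big; apply: eq_bigl => p; rewrite andbT.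
  rewrite -mulr_suml.
  apply: (le_trans (ler_wpM2r _ (card_latv_le _ _ _))).
    by rewrite mulrn_wge0// expR_ge0.
  rewrite -[q *+ 2]mulr_natl mulrCA ler_pM2l// /q -expRD ler_expR.
  (* The constant 2^11 is 512 times the 4 coming from (eps / 2)^2. Then t >= 1 absorbs the size of
     the net: 18 n - 19 t^2 n <= - t^2 n. *)
  have te : 19 * (t ^+ 2 * n%:R) <= eps ^+ 2 * N%:R / (2 ^+ 11 * L ^+ 4).
    rewrite ler_pdivlMr ?mulr_gt0 ?exprn_gt0//.
    rewrite -ler_pdivrMl ?exprn_gt0//; apply: le_trans NC.
    by rewrite le_eqVlt; apply/orP; left; apply/eqP; field; rewrite gt_eqF.
  have tn : n%:R <= t ^+ 2 * n%:R by rewrite ler_peMl ?exprn_ege1// ltW.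
  rewrite (_ : (eps / 2) ^+ 2 * N%:R / (512 * L ^+ 4) =
      eps ^+ 2 * N%:R / (2 ^+ 11 * L ^+ 4)); first by lra.
  by field; rewrite gt_eqF.
rewrite -(setCK good) probability_setC; last exact: measurableC.
rewrite EFinB leeB//; apply: le_trans PB.
by apply: le_measure; rewrite ?inE//; exact: measurableC.
Qed.
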